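(* Let $(X,d_X)$ and $(Y,d_Y)$ be finite pseudo-metric spaces, let $\mathrm{VR}(X)$ and $\mathrm{VR}(Y)$ denote their Vietoris-Rips filtrations, and let $d\ge 0$ be an integer. Then $$d^{E}_{\mathrm{Dgm}}\big(\mathrm{PD}_d^{\mathrm{VR}(X)},\mathrm{PD}_d^{\mathrm{VR}(Y)}\big)\ \le\ 2\cdot d^{E}_{\mathrm{CatMet}}\big((X,d_X),(Y,d_Y)\big)\ =\ 4\cdot d_{\mathrm{GH}}\big((X,d_X),(Y,d_Y)\big).$$
   Context: **Pseudo-metric spaces.** A finite pseudo-metric space $(X,d_X)$ is a non-empty finite set $X$ with a symmetric function $d_X:X\times X\to[0,\infty)$ satisfying the triangle inequality and $d_X(a,a)=0$. **Gromov-Hausdorff distance.** A tripod between sets $X,Y$ is a set $Z$ with surjections $\phi_X:Z\to X$, $\phi_Y:Z\to Y$; its distortion is $\max_{z_1,z_2\in Z}|d_X(\phi_X(z_1),\phi_X(z_2))-d_Y(\phi_Y(z_1),\phi_Y(z_2))|$. For finite pseudo-metric spaces, $d_{\mathrm{GH}}(X,Y)$ is $\tfrac12$ times the infimum of the distortions of all tripods between $X$ and $Y$. **Edit distance.** If $\mathcal C$ is a category whose every morphism $f$ carries a cost $\mathrm{cost}_{\mathcal C}(f)\in[0,\infty)$, a path between objects $A,B$ is a finite sequence of morphisms $A\leftrightarrow D_1\leftrightarrow\cdots\leftrightarrow D_{k-1}\leftrightarrow B$, each $\leftrightarrow$ being a morphism in either direction; the cost of a path is the sum of the costs of its morphisms.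 The edit distance $d^E_{\mathcal C}(A,B)$ is the infimum of the costs of all paths between $A$ and $B$ (with $\inf\emptyset=+\infty$). **CatMet.** Objects: finite pseudo-metric spaces. Morphisms $(X,d_X)\to(Y,d_Y)$ (metric morphisms): surjective functions $f:X\to Y$ such that $d_X(x_1,x_2)\ge d_X(x_3,x_4)$ implies $d_Y(f(x_1),f(x_2))\ge d_Y(f(x_3),f(x_4))$ for all $x_i\in X$. Cost: $\max_{x_1,x_2\in X}|d_X(x_1,x_2)-d_Y(f(x_1),f(x_2))|$. **Intervals and Galois connections.** For a poset $Q$, $\bar Q=\{[q_1,q_2]: q_1\le q_2 \text{ in } Q\}$ with the product order ($[q_1,q_2]\le[q_3,q_4]$ iff $q_1\le q_3$ and $q_2\le q_4$), and $\mathrm{diag}(\bar Q)=\{[q,q]:q\in Q\}$. A Galois connection $f:Q\leftrightarrows R:g$ is a pair of order-preserving maps with $f(q)\le r\iff q\le g(r)$. An order-preserving $f:Q\to R$ induces $\bar f:\bar Q\to\bar R$, $\bar f([q_1,q_2])=[f(q_1),f(q_2)]$. **Dgm.** A persistence diagram is a function $\sigma:\bar Q\to\mathbb N$ where $Q\subseteq[0,\infty)$ is finite with $0\in Q$. A morphism from $\sigma:\bar Q\to\mathbb N$ to $\tau:\bar R\to\mathbb N$ is a Galois connection $f:Q\leftrightarrows R:g$ such that $\tau(J)=\sum_{I\in\bar Q,\ \bar f(I)=J}\sigma(I)$ for all $J\in\bar R\setminus\mathrm{diag}(\bar R)$. Its cost is $\max_{I,J\in\bar Q}\big|\,\|I-J\|_\infty-\|\bar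 f(I)-\bar f(J)\|_\infty\big|$, where $[q_1,q_2]-[q_3,q_4]=(q_1-q_3,q_2-q_4)\in\mathbb R^2$. Category of persistence diagrams: $\mathrm{Dgm}$. **Vietoris-Rips filtration.** For a finite pseudo-metric space, $D(X,d_X)=\mathrm{im}(d_X)\subseteq[0,\infty)$; $\mathrm{VR}(X)$ sends $r\in D(X,d_X)$ to the simplicial complex of all non-empty subsets of $X$ of diameter at most $r$. **Persistence diagram of a filtration.** Fix a field $\Bbbk$. A 1-parameter filtration is an order-preserving map $F$ from a finite $Q\subseteq[0,\infty)$ with $0\in Q$ to the poset of subcomplexes of a finite simplicial complex $K$, with $F(\max Q)=K$. With $Z_d$, $B_d$ the spaces of simplicial $d$-cycles and $d$-boundaries over $\Bbbk$, regarded as subspaces of the $d$-th chain space of $K$, put $\mathrm{ZB}_d^F([q_i,q_j])=\dim\big(Z_d(F(q_i))\cap B_d(F(q_j))\big)$ for $[q_i,q_j]\in\bar Q$. Then $\mathrm{PD}_d^F:\bar Q\to\mathbb Z$ is the Möbius inverse of $\mathrm{ZB}_d^F$, i.e. the unique function with $\mathrm{ZB}_d^F(I)=\sum_{I'\le I}\mathrm{PD}_d^F(I')$ for all $I\in\bar Q$. It is known that it takes values in $\mathbb N$. *)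

(* Defs.v *)
From HB Require Import structures.
From mathcomp Require Import all_boot all_order all_algebra finmap zify.
From mathcomp Require Import all_classical all_reals ereal.

Set Implicit Arguments.
Unset Strict Implicit.
Unset Printing Implicit Defensive.
Import Order.TTheory GRing.Theory Num.Theory.
Local Open Scope fset_scope.
Local Open Scope ring_scope.

Record cost_category (R : realType) := CostCategory {
  obj :> Type;
  mor : obj -> obj -> Type;
  mor_id : forall A, mor A A;
  mor_comp : forall A B C, mor B C -> mor A B -> mor A C;
  mor_compA : forall A B C D (h : mor C D) (g : mor B C) (f : mor A B),
    mor_comp h (mor_comp g f) = mor_comp (mor_comp h g) f;
  mor_id_l : forall A B (f : mor A B), mor_comp (mor_id B) f = f;
  mor_id_r : forall A B (f : mor A B), mor_comp f (mor_id A) = f;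
  cost : forall A B, mor A B -> R;
  cost_ge0 : forall A B (f : mor A B), 0 <= cost f }.

Section EditDistance.
Variables (R : realType) (C : cost_category R).

Inductive zigzag : C -> C -> Type :=
| zz_nil A : zigzag A A
| zz_fwd A D B : mor A D -> zigzag D B -> zigzag A B
| zz_bwd A D B : mor D A -> zigzag D B -> zigzag A B.

Fixpoint zigzag_cost A B (p : zigzag A B) : R :=
  match p with
  | zz_nil _ => 0
  | zz_fwd _ _ _ f q => cost f + zigzag_cost q
  | zz_bwd _ _ _ f q => cost f + zigzag_cost q
  end.

Definition edit_dist (A B : C) : \bar R :=
  ereal_inf [set e : \bar R | exists p : zigzag A B, e = (zigzag_cost p)%:E].

End EditDistance.
Arguments edit_dist {R} C A B.

Record fpmet (R : realType) := FPMet {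
  pts :> finType;
  dist : pts -> pts -> R;
  pts_gt0 : (0 < #|pts|)%N;
  dist_ge0 : forall x y, 0 <= dist x y;
  distxx : forall x, dist x x = 0;
  dist_sym : forall x y, dist x y = dist y x;
  dist_triangle : forall x y z, dist x z <= dist x y + dist y z }.

Definition surjective (T U : Type) (f : T -> U) := forall y, exists x, f x = y.

Section GromovHausdorff.
Variables (R : realType) (X Y : fpmet R).

(* The supremum is attained, even for infinite [Z]: [X] and [Y] are finite. *)
Definition distortion (Z : Type) (fX : Z -> X) (fY : Z -> Y) : \bar R :=
  ereal_sup [set e : \bar R | exists z1 z2 : Z,
    e = (`|dist (fX z1) (fX z2) - dist (fY z1) (fY z2)|)%:E].

Definition gh_dist : \bar R :=
  ((2^-1 : R)%:E * ereal_inf [set e : \bar R |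
     exists (Z : Type) (fX : Z -> X) (fY : Z -> Y),
       [/\ surjective fX, surjective fY & e = distortion fX fY]])%E.

End GromovHausdorff.

Section CatMet.
Variable R : realType.

Record metric_mor (X Y : fpmet R) := MetricMor {
  mfun :> X -> Y;
  mfun_surj : surjective mfun;
  mfun_homo : forall x1 x2 x3 x4, dist x1 x2 >= dist x3 x4 ->
    dist (mfun x1) (mfun x2) >= dist (mfun x3) (mfun x4) }.

Definition metric_cost (X Y : fpmet R) (f : metric_mor X Y) : R :=
  \big[Num.max/0]_(x1 : X) \big[Num.max/0]_(x2 : X)
    `|dist x1 x2 - dist (f x1) (f x2)|.

Lemma metric_morP (X Y : fpmet R) (f g : metric_mor X Y) :
  mfun f = mfun g -> f = g.
Proof.
case: f g => [f fs fh] [g gs gh] /= fg; move: fs fh gs gh; rewrite fg => *.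
by congr MetricMor; exact: Prop_irrelevance.
Qed.

Fact surjective_id (T : Type) : surjective (@id T).
Proof. by move=> x; exists x. Qed.

Fact surjective_comp (T U W : Type) (g : U -> W) (f : T -> U) :
  surjective g -> surjective f -> surjective (g \o f).
Proof.
by move=> gs fs z; have [y <-] := gs z; have [x <-] := fs y; exists x.
Qed.

Definition metric_id (X : fpmet R) : metric_mor X X :=
  MetricMor (@surjective_id X) (fun _ _ _ _ h => h).

Definition metric_comp (X Y Z : fpmet R) (g : metric_mor Y Z)
    (f : metric_mor X Y) : metric_mor X Z :=
  MetricMor (surjective_comp (mfun_surj g) (mfun_surj f))
    (fun _ _ _ _ h => mfun_homo g (mfun_homo f h)).

Lemma metric_cost_ge0 (X Y : fpmet R) (f : metric_mor X Y) :
  0 <= metric_cost f.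
Proof. exact: bigmax_ge_id. Qed.

Fact metric_compA (A B C D : fpmet R) (h : metric_mor C D) (g : metric_mor B C)
  (f : metric_mor A B) :
  metric_comp h (metric_comp g f) = metric_comp (metric_comp h g) f.
Proof. exact: metric_morP. Qed.

Fact metric_id_l (A B : fpmet R) (f : metric_mor A B) :
  metric_comp (metric_id B) f = f.
Proof. exact: metric_morP. Qed.

Fact metric_id_r (A B : fpmet R) (f : metric_mor A B) :
  metric_comp f (metric_id A) = f.
Proof. exact: metric_morP. Qed.

Definition CatMet : cost_category R :=
  CostCategory metric_compA metric_id_l metric_id_r metric_cost_ge0.

End CatMet.

HB.instance Definition _ (R : realType) (Q : {fset R}) :=
  [SubChoice_isSubOrder of fset_sub_type Q by <: with ring_display].

(* [*p] makes the induced order on intervals the product order. *)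
Definition ivl d (T : porderType d) := {p : T *p T | (p.1 <= p.2)%O}.

HB.instance Definition _ d (T : porderType d) := SubChoice.on (ivl T).
HB.instance Definition _ d (T : porderType d) :=
  [SubChoice_isSubPOrder of ivl T by <: with d].
HB.instance Definition _ d (T : finPOrderType d) := Finite.on (ivl T).

Section Intervals.
Context {d : Order.disp_t}.

Definition lo (T : porderType d) (I : ivl T) : T := (val I).1.
Definition hi (T : porderType d) (I : ivl T) : T := (val I).2.

Lemma lo_le_hi (T : porderType d) (I : ivl T) : (lo I <= hi I)%O.
Proof. exact: (valP I). Qed.

Lemma ivl_leE (T : porderType d) (I J : ivl T) :
  (I <= J)%O = (lo I <= lo J)%O && (hi I <= hi J)%O.
Proof. by []. Qed.

Definition mk_ivl (T : porderType d) (a b : T) (ab : (a <= b)%O) : ivl T :=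
  exist _ (a, b) ab.

Definition ivl_map (T U : porderType d) (f : T -> U)
    (f_homo : {homo f : a b / (a <= b)%O}) (I : ivl T) : ivl U :=
  mk_ivl (f_homo _ _ (lo_le_hi I)).

Lemma ivlP (T : porderType d) (I J : ivl T) :
  lo I = lo J -> hi I = hi J -> I = J.
Proof.
by case: I J => [[a b] ab] [[a' b'] ab']; rewrite /lo /hi /= => h h';
   subst a' b'; congr exist; exact: Prop_irrelevance.
Qed.

Record galois (T U : porderType d) := Galois {
  left_adj : T -> U;
  right_adj : U -> T;
  left_homo : {homo left_adj : a b / (a <= b)%O};
  right_homo : {homo right_adj : a b / (a <= b)%O};
  galoisP : forall a b, (left_adj a <= b)%O <-> (a <= right_adj b)%O }.

Lemma galois_ext (T U : porderType d) (f g : galois T U) :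
  left_adj f = left_adj g -> right_adj f = right_adj g -> f = g.
Proof.
case: f g => [f f' ? ? ?] [g g' ? ? ?] /= h h'; subst g g'.
by congr Galois; exact: Prop_irrelevance.
Qed.

Definition galois_id (T : porderType d) : galois T T :=
  @Galois T T id id (fun _ _ h => h) (fun _ _ h => h) (fun _ _ => iff_refl _).

Definition galois_comp (T U W : porderType d) (g : galois U W)
    (f : galois T U) : galois T W :=
  @Galois T W (left_adj g \o left_adj f) (right_adj f \o right_adj g)
    (fun _ _ h => left_homo g (left_homo f h))
    (fun _ _ h => right_homo f (right_homo g h))
    (fun a b => iff_trans (galoisP g _ _) (galoisP f _ _)).

End Intervals.

Section Moebius.
Context {d : Order.disp_t} {T : finPOrderType d}.

Lemma moebius_exists (f : T -> int) :
  exists g : T -> int, forall x, f x = \sum_(y | (y <= x)%O) g y.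
Proof.
pose fix mob n (x : T) {struct n} : int :=
  if n is m.+1 then f x - \sum_(y | (y < x)%O) mob m y else 0.
pose below (x : T) := #|[pred y | (y < x)%O]|.
have below_lt (x y : T) : (y < x)%O -> (below y < below x)%N.
  move=> yx; apply: proper_card; apply/fintype.properP; split.
    by apply/fintype.subsetP => z; rewrite !inE => /lt_trans; apply.
  by exists y; rewrite !inE ?ltxx.
have mob_stable n m x : (below x < n)%N -> (below x < m)%N -> mob n x = mob m x.
  elim: n m x => [|n IH] [|m] x //= xn xm; congr (_ - _).
  apply: eq_bigr => y yx; apply: IH;
    by apply: leq_trans (below_lt _ _ yx) _; rewrite -ltnS.
exists (fun x => mob (below x).+1 x) => x.
rewrite (bigD1 x) //= -[LHS](subrK (\sum_(y | (y < x)%O) mob (below x) y)).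
congr (_ + _); rewrite [RHS](eq_bigl (fun y => (y < x)%O)); last first.
  by move=> y; rewrite lt_def andbC eq_sym.
by apply: eq_bigr => y yx; rewrite -/(mob (below y).+1 y); apply: mob_stable;
   rewrite ?ltnS //; exact: below_lt.
Qed.

Lemma moebius_unique (g h : T -> int) :
  (forall x, \sum_(y | (y <= x)%O) g y = \sum_(y | (y <= x)%O) h y) -> g =1 h.
Proof.
move=> gh x; have [n] := ubnP #|[pred y | (y < x)%O]|.
elim: n x => // n IH x xn; move: (gh x).
rewrite !(bigD1 (P := fun y => (y <= x)%O) x) //=.
suff -> : \sum_(y | (y <= x)%O && (y != x)) g y
        = \sum_(y | (y <= x)%O && (y != x)) h y by move/addIr.
apply: eq_bigr => y; rewrite andbC eq_sym -lt_def => yx; apply: IH.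
rewrite ltnS in xn; apply: leq_trans xn; apply: proper_card.
apply/fintype.properP; split.
  by apply/fintype.subsetP => z; rewrite !inE => /lt_trans; apply.
by exists y; rewrite !inE ?ltxx.
Qed.

Definition moebius_inv (f : T -> int) : T -> int :=
  sval (cid (moebius_exists f)).

Lemma moebius_invP (f : T -> int) x :
  f x = \sum_(y | (y <= x)%O) moebius_inv f y.
Proof. exact: (svalP (cid (moebius_exists f))). Qed.

End Moebius.

Record scale (R : realType) := Scale {
  scale_pts :> {fset R};
  scale0 : 0 \in scale_pts;
  scale_ge0 : forall q, q \in scale_pts -> 0 <= q }.

Record pdiagram (R : realType) := PDiagram {
  pd_scale : scale R;
  pd_mult :> ivl pd_scale -> nat }.

Definition ivl_dist (R : realType) (Q : scale R) (I J : ivl Q) : R :=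
  Num.max `|val (lo I) - val (lo J)| `|val (hi I) - val (hi J)|.

Section Dgm.
Variable R : realType.

Record dgm_mor (s t : pdiagram R) := DgmMor {
  dgm_galois :> galois (pd_scale s) (pd_scale t);
  dgm_mult : forall J : ivl (pd_scale t), lo J != hi J ->
    t J = (\sum_(I : ivl (pd_scale s) |
              ivl_map (left_homo dgm_galois) I == J) s I)%N }.

Definition dgm_cost (s t : pdiagram R) (f : dgm_mor s t) : R :=
  \big[Num.max/0]_(I : ivl (pd_scale s)) \big[Num.max/0]_(J : ivl (pd_scale s))
    `|ivl_dist I J
      - ivl_dist (ivl_map (left_homo f) I) (ivl_map (left_homo f) J)|.

Lemma dgm_morP (s t : pdiagram R) (f g : dgm_mor s t) :
  dgm_galois f = dgm_galois g -> f = g.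
Proof.
case: f g => [f ?] [g ?] /= h; subst g.
by congr DgmMor; exact: Prop_irrelevance.
Qed.

Fact dgm_id_mult (s : pdiagram R) (J : ivl (pd_scale s)) : lo J != hi J ->
  s J = (\sum_(I : ivl (pd_scale s) |
            ivl_map (left_homo (galois_id (pd_scale s))) I == J) s I)%N.
Proof.
by move=> _; rewrite (big_pred1 J) // => I /=; congr (_ == _); exact: ivlP.
Qed.

Definition dgm_id (s : pdiagram R) : dgm_mor s s := DgmMor (@dgm_id_mult s).

Fact dgm_comp_mult (s t u : pdiagram R) (g : dgm_mor t u) (f : dgm_mor s t)
    (K : ivl (pd_scale u)) : lo K != hi K ->
  u K = (\sum_(I : ivl (pd_scale s) |
            ivl_map (left_homo (galois_comp g f)) I == K) s I)%N.
Proof.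
move=> K_off; rewrite (dgm_mult g K_off).
rewrite (eq_bigr (fun J => \sum_(I : ivl (pd_scale s) |
           ivl_map (left_homo f) I == J) s I)%N); last first.
  move=> J /eqP JK; apply: dgm_mult; apply: contra_neq K_off => J_diag.
  by rewrite -JK /ivl_map /lo /hi /= -/(lo J) -/(hi J) J_diag.
rewrite (exchange_big_dep xpredT) //= [RHS]big_mkcond; apply: eq_bigr => I _.
have -> : ivl_map (left_homo (galois_comp g f)) I
        = ivl_map (left_homo g) (ivl_map (left_homo f) I) by exact: ivlP.
case: ifP => IK.
  rewrite (big_pred1 (ivl_map (left_homo f) I)) // => J /=.
  by rewrite andbC eq_sym; case: eqP => [->|].
by rewrite big1 // => J /andP[JK /eqP IJ]; rewrite IJ JK in IK.
Qed.

Definition dgm_comp (s t u : pdiagram R) (g : dgm_mor t u) (f : dgm_mor s t) :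
  dgm_mor s u := DgmMor (dgm_comp_mult g f).

Lemma dgm_cost_ge0 (s t : pdiagram R) (f : dgm_mor s t) : 0 <= dgm_cost f.
Proof. exact: bigmax_ge_id. Qed.

Fact dgm_compA (A B C D : pdiagram R) (h : dgm_mor C D) (g : dgm_mor B C)
  (f : dgm_mor A B) :
  dgm_comp h (dgm_comp g f) = dgm_comp (dgm_comp h g) f.
Proof. by apply: dgm_morP; exact: galois_ext. Qed.

Fact dgm_id_l (A B : pdiagram R) (f : dgm_mor A B) : dgm_comp (dgm_id B) f = f.
Proof. by apply: dgm_morP; exact: galois_ext. Qed.

Fact dgm_id_r (A B : pdiagram R) (f : dgm_mor A B) : dgm_comp f (dgm_id A) = f.
Proof. by apply: dgm_morP; exact: galois_ext. Qed.

Definition Dgm : cost_category R :=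
  CostCategory dgm_compA dgm_id_l dgm_id_r dgm_cost_ge0.

End Dgm.

Record complex (V : finType) := Complex {
  faces :> {set {set V}};
  face_neq0 : finset.set0 \notin faces;
  face_sub : forall s t : {set V},
    s \in faces -> t \subset s -> t != finset.set0 -> t \in faces }.

Section Chains.
Variables (k : fieldType) (V : finType).

(* All complexes on [V] share this ambient space, the chains (in all degrees)
   of the full simplex on [V], augmented by a copy of [k] at the empty set that
   no chain of a complex meets. *)
Definition chain : vectType k := {ffun {set V} -> k^o}.

Definition simplex (s : {set V}) : chain := [ffun t => (t == s)%:R].

(* Simplices are oriented by the enumeration order of [V]. *)
Definition face_sign (s : {set V}) (v : V) : k :=
  (-1) ^+ #|[set w in s | (enum_rank w < enum_rank v)%N]|.

(* Vertices have boundary [0]: homology is not reduced. *)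
Definition simplex_boundary (s : {set V}) : chain :=
  if (1 < #|s|)%N then \sum_(v in s) face_sign s v *: simplex (s :\ v) else 0.

Definition boundary_fun (c : chain) : chain :=
  \sum_(s : {set V}) (c : {ffun {set V} -> k^o}) s *: simplex_boundary s.

Fact boundary_fun_linear : linear boundary_fun.
Proof.
move=> a c c'; rewrite /boundary_fun scaler_sumr -big_split /=.
by apply: eq_bigr => s _; rewrite !ffunE scalerDl scalerA.
Qed.
HB.instance Definition _ :=
  GRing.isLinear.Build k chain chain _ boundary_fun boundary_fun_linear.

Definition boundary : 'End(chain) := linfun boundary_fun.

Definition chains (d : nat) (L : complex V) : {vspace chain} :=
  <<[seq simplex s | s in [set s in faces L | #|s| == d.+1]]>>%VS.

Lemma chains_mono d (L M : complex V) :
  faces L \subset faces M -> (chains d L <= chains d M)%VS.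
Proof.
move=> /fintype.subsetP LM; apply: sub_span => c /mapP[s].
rewrite mem_enum !inE => /andP[sL sd] ->; apply: map_f.
by rewrite mem_enum !inE sd LM.
Qed.

Definition cycles (d : nat) (L : complex V) : {vspace chain} :=
  (chains d L :&: lker boundary)%VS.

Definition boundaries (d : nat) (L : complex V) : {vspace chain} :=
  (boundary @: chains d.+1 L)%VS.

Lemma cycles_mono d (L M : complex V) :
  faces L \subset faces M -> (cycles d L <= cycles d M)%VS.
Proof.
move=> LM; apply: capvS => //; exact: chains_mono.
Qed.

Lemma boundaries_mono d (L M : complex V) :
  faces L \subset faces M -> (boundaries d L <= boundaries d M)%VS.
Proof. by move=> LM; apply: limgS; exact: chains_mono. Qed.

End Chains.

Section MoebiusDim.
Context {d : Order.disp_t} {T : finOrderType d}.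
Context {k : fieldType} {W : vectType k}.
Variables (Z B : T -> {vspace W}).
Hypotheses (Z_homo : forall a b, (a <= b)%O -> (Z a <= Z b)%VS)
           (B_homo : forall a b, (a <= b)%O -> (B a <= B b)%VS).

Let dimZB (I : ivl T) : int := (\dim (Z (lo I) :&: B (hi I)))%:Z.
Let m := moebius_inv dimZB.
Let S (P Q : pred T) : int := \sum_(J : ivl T | P (lo J) && Q (hi J)) m J.

Let S_dim (a b : T) : (a <= b)%O ->
  S (fun x : T => (x <= a)%O) (fun y : T => (y <= b)%O)
  = (\dim (Z a :&: B b))%:Z.
Proof. by move=> ab; rewrite [RHS](moebius_invP dimZB (mk_ivl ab)). Qed.

Let eqS P P' Q Q' : P =1 P' -> Q =1 Q' -> S P Q = S P' Q'.
Proof. by move=> eP eQ; apply: eq_bigl => J; rewrite eP eQ. Qed.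

Let max_lt (a x : T) : (x < a)%O ->
  exists2 p, (x <= p < a)%O & forall y, (y < a)%O = (y <= p)%O.
Proof.
move=> xa; case: (@arg_maxP _ _ _ x (fun y : T => (y < a)%O) id xa).
move=> p pa maxp.
exists p; first by rewrite pa andbT; exact: maxp.
by move=> y; apply/idP/idP => [/maxp|/le_lt_trans] //; apply.
Qed.

Let S_lt (a : T) : exists2 Z' : {vspace W}, (Z' <= Z a)%VS &
  forall b, (a <= b)%O ->
    S (fun x : T => (x < a)%O) (fun y : T => (y <= b)%O)
  = (\dim (Z' :&: B b))%:Z.
Proof.
have [[x xa]|none] := pselect (exists x : T, (x < a)%O).
  have [p /andP[_ pa] ltE] := max_lt xa.
  exists (Z p) => [|b ab]; first exact/Z_homo/ltW.
  rewrite -S_dim; last exact: le_trans (ltW pa) ab.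
  exact: eqS.
exists 0%VS => [|b ab]; first exact: sub0v.
rewrite cap0v dimv0 /S big_pred0 // => J.
by apply/negbTE/negP => /andP[Ja _]; apply: none; exists (lo J).
Qed.

Let S_split (a : T) Q :
  S (fun x : T => (x <= a)%O) Q = S (fun x : T => (x < a)%O) Q + S (pred1 a) Q.
Proof.
rewrite /S (bigID (fun J : ivl T => lo J < a)%O) /=.
congr (_ + _); apply: eq_bigl => J; rewrite andbAC; congr (_ && _).
  by apply/andP/idP => [[]|h] //; rewrite ltW.
by rewrite -leNgt eq_le.
Qed.

Lemma moebius_dim_ge0 (I : ivl T) : 0 <= moebius_inv dimZB I.
Proof.
rewrite -/m; set a := lo I; set b := hi I.
have ab : (a <= b)%O := lo_le_hi I.
have [Z' Z'a SZ'] := S_lt a.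
have mI : m I = S (pred1 a) (fun y : T => (y <= b)%O)
            - S (pred1 a) (fun y : T => (y < b)%O).
  rewrite {1}/S (bigD1 I) /=; last by rewrite eqxx lexx.
  rewrite -addrA [X in _ + X](_ : _ = 0) ?addr0 //; apply/eqP.
  rewrite subr_eq0; apply/eqP/eq_bigl => J /=; rewrite -andbA.
  have [Ja|//] := eqVneq (lo J) a; rewrite /= lt_neqAle andbC; congr andb.
  congr negb; apply/eqP/eqP => [->|Jb] //; exact: ivlP.
have diag c : S (pred1 a) (fun y : T => (y <= c)%O) =
    S (fun x : T => (x <= a)%O) (fun y : T => (y <= c)%O)
    - S (fun x : T => (x < a)%O) (fun y : T => (y <= c)%O).
  by rewrite S_split addrC addKr.
rewrite mI diag S_dim // SZ' //.
have [a_b|ab'] := eqVneq a b.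
  rewrite [X in _ - X]/S big_pred0 ?subr0; last first.
    move=> J /=; apply/negbTE/negP => /andP[/eqP Ja].
    by rewrite -a_b -Ja ltNge lo_le_hi.
  by rewrite subr_ge0 lez_nat dimvS // capvS.
have altb : (a < b)%O by rewrite lt_neqAle ab' ab.
have [p /andP[ap pb] ltE] := max_lt altb.
rewrite (eqS (fun=> erefl) ltE) diag S_dim // SZ' //.
have := dimv_sum_cap (Z a :&: B p) (Z' :&: B b).
have -> : ((Z a :&: B p) :&: (Z' :&: B b) = Z' :&: B p)%VS.
  rewrite -capvA (capvA (B p)) (capvC (B p)) -capvA capvA (capv_idPr Z'a).
  by rewrite (capv_idPl (B_homo (ltW pb))).
have : (\dim ((Z a :&: B p) + (Z' :&: B b)) <= \dim (Z a :&: B b))%N.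
  apply: dimvS; rewrite subv_add !capvS //; exact/B_homo/ltW.
lia.
Qed.

End MoebiusDim.

(* The ambient complex of a filtration is the last term [fcpx q]; only its
   vertex set needs to be recorded. *)
Record filtration (R : realType) := Filtration {
  fscale : scale R;
  fvert : finType;
  fcpx :> fscale -> complex fvert;
  fcpx_homo : forall q r : fscale,
    (q <= r)%O -> faces (fcpx q) \subset faces (fcpx r) }.

Section PersistenceDiagram.
Variables (R : realType) (k : fieldType) (d : nat) (F : filtration R).

Definition ZB (I : ivl (fscale F)) : int :=
  (\dim (cycles k d (F (lo I)) :&: boundaries k d (F (hi I))))%:Z.

Definition PD : ivl (fscale F) -> int := moebius_inv ZB.

Lemma PD_moebius I : ZB I = \sum_(J | (J <= I)%O) PD J.
Proof. exact: moebius_invP. Qed.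

Lemma PD_ge0 I : 0 <= PD I.
Proof.
apply: (moebius_dim_ge0 (Z := fun q => cycles k d (F q))
                        (B := fun q => boundaries k d (F q))) => a b ab.
- exact/cycles_mono/fcpx_homo.
- exact/boundaries_mono/fcpx_homo.
Qed.

(* By [PD_ge0], the absolute value is only a cast from [int] to [nat]. *)
Definition PD_diagram : pdiagram R :=
  @PDiagram R (fscale F) (fun I => `|PD I|%N).

End PersistenceDiagram.

Section VietorisRips.
Variables (R : realType) (X : fpmet R).

Definition dist_fset : {fset R} := [fset dist x y | x in X, y in X]%fset.

Fact dist_fset0 : 0 \in dist_fset.
Proof.
have /card_gt0P[x _] := pts_gt0 X.
by apply/imfset2P; exists x => //; exists x => //; rewrite distxx.
Qed.

Fact dist_fset_ge0 q : q \in dist_fset -> 0 <= q.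
Proof. by move=> /imfset2P[x _ [y _ ->]]; exact: dist_ge0. Qed.

Definition dist_scale : scale R := Scale dist_fset0 dist_fset_ge0.

Definition diam (s : {set X}) : R :=
  \big[Num.max/0]_(x in s) \big[Num.max/0]_(y in s) dist x y.

Lemma diam_leP (s : {set X}) (r : R) : 0 <= r ->
  reflect (forall x y, x \in s -> y \in s -> dist x y <= r) (diam s <= r).
Proof.
move=> r0; apply: (iffP (bigmax_leP _ _ _ _)) => [[_ h] x y xs ys|h].
  by have /bigmax_leP[_] := h x xs; apply.
by split=> // x xs; apply/bigmax_leP; split=> // y ys; exact: h.
Qed.

Definition VR_faces (r : R) : {set {set X}} :=
  [set s : {set X} | (s != finset.set0) && (diam s <= r)].

Fact VR_face_neq0 r : finset.set0 \notin VR_faces r.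
Proof. by rewrite inE eqxx. Qed.

Fact VR_face_sub (r : dist_scale) (s t : {set X}) : s \in VR_faces (val r) ->
  t \subset s -> t != finset.set0 -> t \in VR_faces (val r).
Proof.
have r0 : 0 <= val r by exact: scale_ge0 (valP r).
rewrite !inE => /andP[_ /(diam_leP _ r0) sr] ts -> /=.
apply/(diam_leP _ r0) => x y xt yt.
by apply: sr; exact: fintype.subsetP ts _ _.
Qed.

Definition VR_complex (r : dist_scale) : complex X :=
  Complex (VR_face_neq0 (val r)) (@VR_face_sub r).

Fact VR_homo (q r : dist_scale) : (q <= r)%O ->
  faces (VR_complex q) \subset faces (VR_complex r).
Proof.
move=> qr; apply/fintype.subsetP => s.
by rewrite !inE => /andP[-> /le_trans]; apply.
Qed.

Definition VR : filtration R := Filtration VR_homo.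

End VietorisRips.

(* Main.v *)
From HB Require Import structures.
Require Import Defs.
From mathcomp Require Import all_boot all_order all_algebra finmap lra ring.
From mathcomp Require Import all_classical all_reals ereal.

Set Implicit Arguments.
Unset Strict Implicit.
Unset Printing Implicit Defensive.
Import Order.TTheory GRing.Theory Num.Theory.
Local Open Scope ring_scope.

(** The two halves of the statement have separate reasons.

    The inequality holds because Vietoris-Rips persistence is functorial up
    to a factor 2 in the cost. A metric morphism f from X to Y induces a
    monotone map of distance sets sending dist x y to dist (f x) (f y); this
    is a map of finite chains that preserves the least element, so it has a
    right adjoint g. By the definition of g, the complex VR(X) at g(r) is
    the full preimage under f of VR(Y) at r. Comparing homology along a full
    preimage shows that, for each interval [r, s], the dimension of Z(VR(X),
    g r) /\ B(VR(X), g s) exceeds its analogue for Y by the dimension of the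
    cycles at g r which f kills ([dim_cycle_boundary_preimage]). This excess
    depends on r only, so its Moebius inverse lives on the diagonal; and
    Moebius inversion turns precomposition with a right adjoint into
    push-forward along the left adjoint ([moebius_galois]). Thus f induces a
    morphism of diagrams ([VR_dgm_mor]). Interval distances are differences
    of two distances, each of which moves by at most the cost of f: that is
    the factor 2. Applying this to every step of a zigzag gives
    [edit_dist_VR].

    The homology comparison uses the exterior algebra on the vertices.
    Wedging with a vertex anticommutes, and the augmented boundary is the
    antiderivation that sends each vertex to 1. Hence a map of vertices acts
    on chains ([push]), and prisms give a chain homotopy from the identity
    to the action of a self-map ([prism_homotopy]). For the composite of f
    and a section of f, every prism stays inside a full preimage under f; so
    a cycle killed by f_* bounds, while the section shows that f_* hits
    every cycle downstairs that bounds.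

    The equality says that edit distance is the infimum of the distortions
    of tripods. A zigzag gives a tripod by iterated pullback, distortions
    being subadditive ([zigzag_tripod]). Conversely, pull both metrics back
    to a finite tripod and move along the straight segment between them. The
    order of the pairwise distances changes at finitely many instants only;
    between two such instants it is constant, and at these instants strict
    inequalities can only become equalities, so the identity is a metric
    morphism from inside each open interval to both of its ends. The costs
    add up to the length of the segment ([zigzag_segment], [tripod_zigzag]). *)

(** * Chains as an exterior algebra on the vertices *)

Section Chains.
Variables (k : fieldType) (V : finType).
Local Notation C := (chain k V).
Local Notation simp := (@simplex k V).
Implicit Types (s t : {set V}) (u v : V) (c : C).

Section Extension.
Variables (W : vectType k) (F : {set V} -> W).

Definition extend_fun (c : C) : W :=
  \sum_(s : {set V}) (c : {ffun {set V} -> k^o}) s *: F s.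

Fact extend_fun_linear : linear extend_fun.
Proof.
move=> a c c'; rewrite /extend_fun scaler_sumr -big_split /=.
by apply: eq_bigr => s _; rewrite !ffunE scalerDl scalerA.
Qed.
HB.instance Definition _ :=
  GRing.isLinear.Build k C W _ extend_fun extend_fun_linear.

Definition extend : 'Hom(C, W) := linfun extend_fun.

Lemma extendE s : extend (simp s) = F s.
Proof.
rewrite lfunE /= /extend_fun (bigD1 s) //= big1 ?addr0 => [|t ts].
  by rewrite ffunE eqxx scale1r.
by rewrite ffunE (negbTE ts) scale0r.
Qed.

End Extension.

Definition simplices (A : {set {set V}}) : {vspace C} :=
  <<[seq simp s | s in A]>>%VS.

Lemma mem_simplices (A : {set {set V}}) s : s \in A -> simp s \in simplices A.
Proof. by move=> sA; apply/memv_span/map_f; rewrite mem_enum. Qed.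

Lemma simplicesS (A B : {set {set V}}) :
  A \subset B -> (simplices A <= simplices B)%VS.
Proof.
move=> /fintype.subsetP AB; apply/span_subvP => c /mapP[s].
by rewrite mem_enum => /AB sB ->; exact: mem_simplices.
Qed.

Lemma simplices_img (W : vectType k) (T : 'Hom(C, W)) (A : {set {set V}})
    (U : {vspace W}) :
  (forall s, s \in A -> T (simp s) \in U) ->
  forall c, c \in simplices A -> T c \in U.
Proof.
move=> h c cA; have : T c \in (T @: simplices A)%VS by exact: memv_img.
rewrite limg_span; apply: subvP; apply/span_subvP.
move=> _ /mapP[_ /mapP[s + ->] ->].
by rewrite mem_enum; exact: h.
Qed.

Lemma simplices_eq (W : vectType k) (S T : 'Hom(C, W)) (A : {set {set V}}) :
  (forall s, s \in A -> S (simp s) = T (simp s)) ->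
  forall c, c \in simplices A -> S c = T c.
Proof.
move=> h c cA; apply/eqP; rewrite -subr_eq0 -opp_lfunE -add_lfunE -memv0.
move: c cA; apply: simplices_img => s sA.
by rewrite memv0 add_lfunE opp_lfunE h // subrr.
Qed.

Lemma hom_ext (W : vectType k) (S T : 'Hom(C, W)) :
  (forall s, S (simp s) = T (simp s)) -> S = T.
Proof.
move=> h; apply/lfunP => c; apply: (@simplices_eq _ _ _ [set: {set V}]) => //.
have -> : c = \sum_(s : {set V}) (c : {ffun {set V} -> k^o}) s *: simp s.
  apply/ffunP => t; rewrite sum_ffunE (bigD1 t) //= big1 ?addr0 => [|s st].
    by rewrite !ffunE eqxx; exact/esym/mulr1.
  by rewrite !ffunE eq_sym (negbTE st); exact: mulr0.
by apply: memv_suml => s _; apply/memvZ/mem_simplices; rewrite inE.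
Qed.

(** The order of vertices that orients the simplices. *)
Definition earlier v u := (enum_rank v < enum_rank u)%N.

Lemma earlierN u v : u != v -> earlier v u = ~~ earlier u v.
Proof.
move=> uv; rewrite /earlier -leqNgt ltn_neqAle.
by rewrite (inj_eq val_inj) (inj_eq enum_rank_inj) eq_sym uv.
Qed.

Lemma face_sign_sq s v : face_sign k s v * face_sign k s v = 1.
Proof. by rewrite -expr2 sqrr_sign. Qed.

Lemma face_sign_self s v : face_sign k (v |: s) v = face_sign k s v.
Proof.
congr (_ ^+ _); apply: eq_card => w; rewrite !inE.
by case: eqVneq => [->|]; rewrite ?ltnn ?andbF.
Qed.

Lemma face_signU1 s u v : u \notin s ->
  face_sign k (u |: s) v = (-1) ^+ earlier u v * face_sign k s v.
Proof.
move=> us; rewrite /face_sign -exprD; congr (_ ^+ _).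
rewrite (cardD1 u) !inE eqxx /=; congr (_ + _)%N.
apply: eq_card => w; rewrite !inE; case: eqVneq => //= ->.
by rewrite (negbTE us).
Qed.

(** Exactly one of u, v precedes the other, so inserting both vertices in
    the two possible orders gives opposite signs. *)
Lemma face_sign_swap s u v : u != v -> u \notin s -> v \notin s ->
  face_sign k s u * face_sign k (u |: s) v
  = - (face_sign k s v * face_sign k (v |: s) u).
Proof.
move=> uv us vs; rewrite !face_signU1 // (earlierN uv) signrN.
by rewrite mulNr mulrN opprK mulrCA [in RHS]mulrCA [face_sign k s u * _]mulrC.
Qed.

(** Left exterior multiplication by v, in the basis of oriented simplices. *)
Definition wedge v : 'End(C) :=
  extend (fun s => if v \in s then 0 else face_sign k s v *: simp (v |: s)).

Lemma wedge_in s v : v \in s -> wedge v (simp s) = 0.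
Proof. by rewrite extendE => ->. Qed.

Lemma wedge_notin s v : v \notin s ->
  wedge v (simp s) = face_sign k s v *: simp (v |: s).
Proof. by rewrite extendE => /negbTE ->. Qed.

Lemma wedgeK s v : v \in s ->
  wedge v (simp (s :\ v)) = face_sign k s v *: simp s.
Proof.
move=> vs; rewrite wedge_notin ?setD11 // finset.setD1K //.
by rewrite -{3}(finset.setD1K vs) face_sign_self.
Qed.

Lemma wedgewedge u c : wedge u (wedge u c) = 0.
Proof.
suff /lfunP/(_ c) : (wedge u \o wedge u)%VF = 0.
  by rewrite comp_lfunE zero_lfunE.
apply: hom_ext => s; rewrite comp_lfunE zero_lfunE.
have [us|us] := boolP (u \in s); first by rewrite wedge_in ?linear0.
by rewrite wedge_notin // linearZ /= wedge_in ?setU11 ?scaler0.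
Qed.

Lemma wedgeC u v c : wedge u (wedge v c) = - wedge v (wedge u c).
Proof.
have [<-|uv] := eqVneq u v; first by rewrite wedgewedge oppr0.
suff /lfunP/(_ c) : (wedge u \o wedge v)%VF = (- (wedge v \o wedge u))%VF.
  by rewrite opp_lfunE !comp_lfunE.
apply: hom_ext => s; rewrite opp_lfunE !comp_lfunE.
have [us|us] := boolP (u \in s).
  rewrite (wedge_in us) linear0 oppr0.
  have [vs|vs] := boolP (v \in s); first by rewrite wedge_in ?linear0.
  by rewrite wedge_notin // linearZ /= wedge_in ?setU1r ?scaler0.
have [vs|vs] := boolP (v \in s).
  rewrite (wedge_in vs) linear0 wedge_notin // linearZ /= wedge_in ?setU1r //.
  by rewrite scaler0 oppr0.
have uvs : u \notin v |: s by rewrite !inE (negbTE uv).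
have vus : v \notin u |: s by rewrite !inE eq_sym (negbTE uv).
rewrite !wedge_notin // !linearZ /= !wedge_notin // !scalerA finset.setUCA.
by rewrite scalerN scalerA (face_sign_swap uv us vs) scaleNr opprK.
Qed.

(** Unlike [boundary], this sends a vertex to the empty simplex; it is this
    version that is an antiderivation of the exterior algebra. *)
Definition aug_boundary : 'End(C) :=
  extend (fun s => \sum_(v in s) face_sign k s v *: simp (s :\ v)).

Lemma aug_boundary0 : aug_boundary (simp finset.set0) = 0.
Proof. by rewrite extendE big1 // => v; rewrite inE. Qed.

(** Contracting with the functional that is 1 on every vertex: the
    antiderivation rule. With [aug_boundary0] it determines the augmented
    boundary. *)
Lemma aug_boundary_wedge v c :
  aug_boundary (wedge v c) = c - wedge v (aug_boundary c).
Proof.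
suff /lfunP/(_ c) : (aug_boundary \o wedge v)%VF
    = (\1%VF - (wedge v \o aug_boundary))%VF.
  by rewrite add_lfunE opp_lfunE !comp_lfunE id_lfunE.
apply: hom_ext => s; rewrite add_lfunE opp_lfunE !comp_lfunE id_lfunE.
rewrite [aug_boundary (simp s)]extendE linear_sum /=.
have [vs|vs] := boolP (v \in s).
  rewrite (wedge_in vs) linear0 (bigD1 v) //= linearZ /= wedgeK // scalerA.
  rewrite face_sign_sq scale1r big1 ?addr0 ?subrr // => u /andP[us uv].
  by rewrite linearZ /= wedge_in ?scaler0 // !inE eq_sym uv.
rewrite wedge_notin // linearZ /= extendE big_setU1 //= scalerDr scalerA.
rewrite face_sign_self face_sign_sq scale1r finset.setU1K //; congr (_ + _).
rewrite scaler_sumr -sumrN; apply: eq_bigr => u us.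
have uv : u != v by apply: contraNneq vs => <-.
have us' : u \notin s :\ u by rewrite !inE eqxx.
have vs' : v \notin s :\ u by rewrite !inE (negbTE vs) andbF.
have vus : (v |: s) :\ u = v |: (s :\ u).
  apply/setP => w; rewrite !inE; case: (eqVneq w v) => [->|_] //=.
  by rewrite eq_sym uv.
rewrite [wedge v _]linearZ /= (wedge_notin vs') vus !scalerA -scaleNr.
congr (_ *: _); have := face_sign_swap uv us' vs'.
rewrite finset.setD1K // -(face_sign_self (s :\ u)) finset.setD1K //.
rewrite -(face_sign_self (v |: (s :\ u))) finset.setUCA finset.setD1K //.
move=> swap; rewrite -[face_sign k s v]mul1r -(face_sign_sq s u) -mulrA swap.
rewrite mulrN mulNr !mulrA -[_ * _ * face_sign _ _ _ * _]mulrA.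
by rewrite face_sign_sq mulr1.
Qed.

Definition below v s := [forall u in s, earlier v u].

Lemma below_notin v s : below v s -> v \notin s.
Proof.
by move=> /'forall_implyP h; apply/negP => /h; rewrite /earlier ltnn.
Qed.

Lemma sorted_enum s : sorted earlier (enum s).
Proof.
apply: sorted_filter => [? ? ?|]; first exact: ltn_trans.
rewrite -enumT.
rewrite -(@sorted_map _ _ (fun x : V => enum_rank x : nat) ltn (enum V)).
suff -> : map (fun x : V => enum_rank x : nat) (enum V) = iota 0 #|V|.
  exact: iota_ltn_sorted.
apply: (@eq_from_nth _ 0%N); rewrite size_map -cardE ?size_iota // => i iV.
have [x _] : exists x : V, x \in V by apply/card_gt0P/leq_ltn_trans/iV.
rewrite (nth_map x) -?cardE // nth_iota //.
by rewrite -(enum_val_nth x (Ordinal iV)) enum_valK.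
Qed.

Lemma enum_below v s : below v s -> enum (v |: s) = v :: enum s.
Proof.
move=> vs; apply: (@irr_sorted_eq _ earlier).
- by move=> ? ? ?; exact: ltn_trans.
- by move=> ?; exact: ltnn.
- exact: sorted_enum.
- rewrite /= path_min_sorted ?sorted_enum //; apply/allP => u.
  by rewrite mem_enum; exact: (implyP (forallP vs u)).
by move=> u; rewrite inE !mem_enum !inE.
Qed.

(** Every simplex is built from the empty one by adding vertices in front,
    where wedging has sign 1 ([wedge_below]); identities between linear maps
    on chains are proved along this induction. *)
Lemma below_ind (P : {set V} -> Prop) :
  P finset.set0 -> (forall v s, below v s -> P s -> P (v |: s)) ->
  forall s, P s.
Proof.
move=> P0 PU s; have [n] := ubnP #|s|; elim: n s => // n IH s sn.
have [->//|/set0Pn[u us]] := eqVneq s finset.set0.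
case: (@arg_minnP _ u (mem s) (fun v => enum_rank v) us) => v /= vs vmin.
have {}vs : v \in s by [].
rewrite -(finset.setD1K vs); apply: PU.
  apply/'forall_implyP => w; rewrite !inE => /andP[wv ws].
  by rewrite /earlier ltn_neqAle vmin // andbT eq_sym
             (inj_eq val_inj) (inj_eq enum_rank_inj).
by apply: IH; move: sn; rewrite (cardsD1 v) vs.
Qed.

Lemma wedge_below v s : below v s -> wedge v (simp s) = simp (v |: s).
Proof.
move=> vs; rewrite wedge_notin ?below_notin //.
rewrite /face_sign (_ : #|_| = 0)%N ?scale1r //; apply: eq_card0 => u.
rewrite !inE; apply/negbTE/negP => /andP[us].
have := forallP vs u; rewrite us /earlier /= ltnNge.
by move=> /negbTE uv /ltnW; rewrite uv.
Qed.

End Chains.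

Section Induced.
Variables (k : fieldType) (V : finType) (W : vectType k).
Local Notation simp := (@simplex k V).
Implicit Types (s t : {set V}) (u v : V) (c : chain k V).
Variables (a : V -> 'End(W)) (w0 : W).

(** A module over the exterior algebra, given by the operators a v, receives
    a unique module map that sends the empty simplex to w0. *)
Definition induced : 'Hom(chain k V, W) :=
  extend (fun s => foldr (fun v => a v) w0 (enum s)).

Lemma induced0 : induced (simp finset.set0) = w0.
Proof. by rewrite extendE enum_set0. Qed.

Lemma induced_below v s : below v s ->
  induced (simp (v |: s)) = a v (induced (simp s)).
Proof. by move=> vs; rewrite !extendE enum_below. Qed.

Hypotheses (aC : forall u v w, a u (a v w) = - a v (a u w))
           (aa : forall u w, a u (a u w) = 0).

Lemma induced_wedge_below v c :
  c \in simplices k [set s | below v s] ->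
  induced (wedge k v c) = a v (induced c).
Proof.
move=> cv; rewrite -!comp_lfunE; move: c cv; apply: simplices_eq => s.
by rewrite inE !comp_lfunE => vs; rewrite wedge_below // induced_below.
Qed.

(** [induced] respects wedging with an earliest vertex by construction. If
    instead u is an earliest vertex of the simplex and comes before v, both
    sides change sign when v is moved past u. *)
Lemma induced_wedge v c : induced (wedge k v c) = a v (induced c).
Proof.
suff /lfunP/(_ c) : (induced \o wedge k v)%VF = (a v \o induced)%VF.
  by rewrite !comp_lfunE.
apply: hom_ext => s; rewrite !comp_lfunE; elim/below_ind: s v => [|u s us IH] v.
  apply: induced_wedge_below; apply: mem_simplices; rewrite inE.
  by apply/'forall_implyP => u; rewrite inE.
have [->|vu] := eqVneq v u.
  by rewrite wedge_in ?setU11 // linear0 induced_below // aa.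
rewrite induced_below //; have [uv|] := boolP (earlier u v); last first.
  rewrite -earlierN 1?eq_sym // => uv.
  rewrite -induced_below //; apply: induced_wedge_below; apply: mem_simplices.
  rewrite inE; apply/'forall_implyP => w; rewrite !inE => /orP[/eqP -> //|ws].
  by apply: ltn_trans uv _; exact: (implyP (forallP us w)).
rewrite -(wedge_below k us) wedgeC linearN /= induced_wedge_below; last first.
  have [vs|vs] := boolP (v \in s); first by rewrite wedge_in // mem0v.
  rewrite wedge_notin //; apply/memvZ/mem_simplices; rewrite inE.
  apply/'forall_implyP => w; rewrite !inE => /orP[/eqP -> //|].
  exact: (implyP (forallP us w)).
by rewrite IH aC opprK.
Qed.

End Induced.

(** * Chain maps and chain homotopies *)

Section Carriers.
Variables (k : fieldType) (V : finType).
Implicit Types (s t M : {set V}) (c : chain k V).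

(** Chains on n vertices of M. Indexing by the number of vertices keeps the
    empty simplex, at n = 0, which no chain space of a complex contains. *)
Definition carried n M : {vspace chain k V} :=
  simplices k [set t : {set V} | (t \subset M) && (#|t| == n)].

Lemma carried_simplex s M : s \subset M -> simplex k s \in carried #|s| M.
Proof. by move=> sM; apply: mem_simplices; rewrite inE sM eqxx. Qed.

Lemma wedge_carried n v M c :
  v \in M -> c \in carried n M -> wedge k v c \in carried n.+1 M.
Proof.
rewrite /carried => vM; move: c; apply: simplices_img => s.
rewrite inE => /andP[sM /eqP <-].
have [vs|vs] := boolP (v \in s); first by rewrite wedge_in // mem0v.
rewrite wedge_notin //; apply/memvZ/mem_simplices; rewrite inE.
by rewrite finset.subUset finset.sub1set vM sM cardsU1 vs add1n eqxx.
Qed.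

Lemma carried_chains d (L : complex V) M :
  M \in faces L -> (carried d.+1 M <= chains k d L)%VS.
Proof.
move=> ML; apply: simplicesS; apply/fintype.subsetP => t; rewrite !inE.
move=> /andP[tM td]; rewrite td andbT; apply: face_sub ML tM _.
by rewrite -card_gt0 (eqP td).
Qed.

Lemma boundaryE s : boundary k V (simplex k s) = simplex_boundary k s.
Proof. by rewrite -[RHS]extendE /boundary /extend !lfunE. Qed.

Lemma boundary_aug n M c :
  c \in carried n.+2 M -> boundary k V c = aug_boundary k V c.
Proof.
rewrite /carried; move: c; apply: simplices_eq => s.
rewrite inE => /andP[_ /eqP sn].
by rewrite boundaryE /simplex_boundary sn /= extendE.
Qed.

Lemma boundary_small n M c : (n <= 1)%N ->
  c \in carried n M -> boundary k V c = 0.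
Proof.
move=> n1; rewrite /carried => cM; rewrite -[RHS](zero_lfunE _ c); move: c cM.
apply: simplices_eq => s; rewrite inE => /andP[_ /eqP sn].
by rewrite zero_lfunE boundaryE /simplex_boundary sn ltnNge n1.
Qed.

End Carriers.

Section Push.
Variable k : fieldType.

Lemma hom_wedge_ext (V : finType) (W : vectType k) (a : V -> 'End(W))
    (S T : 'Hom(chain k V, W)) :
  S (simplex k finset.set0) = T (simplex k finset.set0) ->
  (forall v c, S (wedge k v c) = a v (S c)) ->
  (forall v c, T (wedge k v c) = a v (T c)) -> S = T.
Proof.
move=> ST0 Sw Tw; apply: hom_ext => s; elim/below_ind: s => // v s vs IH.
by rewrite -(wedge_below k vs) Sw Tw IH.
Qed.

Definition push (V W : finType) (f : V -> W) : 'Hom(chain k V, chain k W) :=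
  induced (fun v => wedge k (f v)) (simplex k finset.set0).

Lemma push0 (V W : finType) (f : V -> W) :
  push f (simplex k finset.set0) = simplex k finset.set0.
Proof. exact: induced0. Qed.

Lemma push_wedge (V W : finType) (f : V -> W) v c :
  push f (wedge k v c) = wedge k (f v) (push f c).
Proof.
by apply: induced_wedge => *; [exact: wedgeC|exact: wedgewedge].
Qed.

Lemma push_id (V : finType) : push (@id V) = \1%VF.
Proof.
apply: (@hom_wedge_ext _ _ (@wedge k V)) => *.
- by rewrite push0 id_lfunE.
- exact: push_wedge.
- by rewrite !id_lfunE.
Qed.

Lemma push_comp (U V W : finType) (g : V -> W) (f : U -> V) :
  push (g \o f) = (push g \o push f)%VF.
Proof.
apply: (@hom_wedge_ext _ _ (fun u => wedge k (g (f u)))) => *.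
- by rewrite comp_lfunE !push0.
- exact: push_wedge.
- by rewrite !comp_lfunE !push_wedge.
Qed.

Lemma aug_boundary_push (V W : finType) (f : V -> W) c :
  aug_boundary k W (push f c) = push f (aug_boundary k V c).
Proof.
rewrite -!comp_lfunE; congr (fun_of_lfun _ c); apply: hom_ext => s.
rewrite !comp_lfunE; elim/below_ind: s => [|v s vs IH].
  by rewrite push0 !aug_boundary0 linear0.
rewrite -(wedge_below k vs) push_wedge !aug_boundary_wedge IH.
by rewrite linearB /= push_wedge.
Qed.

Lemma push_carried (V W : finType) (f : V -> W) s :
  push f (simplex k s) \in carried k #|s| (f @: s).
Proof.
rewrite extendE.
suff carried_word (M : {set V}) : {subset enum s <= M} ->
    foldr (fun v => wedge k (f v)) (simplex k finset.set0) (enum s)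
      \in carried k (size (enum s)) (f @: M).
  by rewrite cardE; apply: carried_word => v; rewrite mem_enum.
elim: (enum s) => [|v l IH] /= lM.
  by rewrite -(cards0 W) carried_simplex // finset.sub0set.
apply: wedge_carried; first by apply/imset_f/lM; rewrite inE eqxx.
by apply: IH => u ul; apply: lM; rewrite inE ul orbT.
Qed.

(** [push] preserves the number of vertices, and the two boundaries agree on
    chains with at least two vertices, so the statement for the augmented
    boundary transfers; with fewer vertices both sides vanish. *)
Lemma boundary_push (V W : finType) (f : V -> W) c :
  boundary k W (push f c) = push f (boundary k V c).
Proof.
rewrite -!comp_lfunE; congr (fun_of_lfun _ c); apply: hom_ext => s.
rewrite !comp_lfunE; have sC := carried_simplex k (fintype.subxx s).
case sn: #|s| (push_carried f s) sC => [|[|n]] fC sC.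
- by rewrite (boundary_small _ fC) // (boundary_small _ sC) // linear0.
- by rewrite (boundary_small _ fC) // (boundary_small _ sC) // linear0.
by rewrite (boundary_aug fC) (boundary_aug sC) aug_boundary_push.
Qed.

Lemma push_chains (V W : finType) (f : V -> W) d (L : complex V)
    (K : complex W) :
  (forall s, s \in faces L -> f @: s \in faces K) ->
  forall c, c \in chains k d L -> push f c \in chains k d K.
Proof.
move=> LK; rewrite /chains -/(simplices _ _).
apply: simplices_img => s; rewrite !inE => /andP[sL /eqP sd].
apply: subvP (carried_chains _ _ (LK _ sL)) _ _; rewrite -sd.
exact: push_carried.
Qed.

End Push.

Section Prism.
Variables (k : fieldType) (V : finType) (g : V -> V).
Implicit Types (s t M : {set V}) (c : chain k V).

(** The simplices of the triangulated prism between a simplex and its image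
    by g. Unlike [push], this depends on the order of the vertices. *)
Fixpoint prism_word (l : seq V) : chain k V :=
  if l is v :: l' then
    wedge k (g v) (wedge k v (simplex k [set u in l']) - prism_word l')
  else 0.

Definition prism : 'End(chain k V) := extend (fun s => prism_word (enum s)).

Lemma prism0 : prism (simplex k finset.set0) = 0.
Proof. by rewrite extendE enum_set0. Qed.

Lemma prism_wedge_below v c : c \in simplices k [set s | below v s] ->
  prism (wedge k v c) = wedge k (g v) (wedge k v c - prism c).
Proof.
move=> cv; rewrite -opp_lfunE -add_lfunE.
rewrite -!comp_lfunE; move: c cv; apply: simplices_eq => s; rewrite inE => vs.
rewrite !comp_lfunE add_lfunE opp_lfunE wedge_below // !extendE enum_below //=.
by rewrite set_enum wedge_below.
Qed.

(** By induction on the simplex. If v comes before all vertices of s, write w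
    for wedging with v, w' for wedging with g v and h for the prism. Then
    h (w s) = w' (w s - h s), the antiderivation rule expands both terms,
    and everything cancels but w s - w' (g_* s) = w s - g_* (w s). *)
Lemma prism_homotopy c :
  aug_boundary k V (prism c) + prism (aug_boundary k V c) = c - push k g c.
Proof.
suff /lfunP/(_ c) : ((aug_boundary k V \o prism) + (prism \o aug_boundary k V)
    = \1 - push k g)%VF.
  by rewrite !add_lfunE opp_lfunE !comp_lfunE id_lfunE.
apply: hom_ext => s.
rewrite !add_lfunE opp_lfunE !comp_lfunE id_lfunE.
elim/below_ind: s => [|v s vs].
  by rewrite prism0 aug_boundary0 !linear0 push0 addr0 subrr.
rewrite -(wedge_below k vs); set c0 := simplex k s => IH.
have sv : c0 \in simplices k [set t | below v t].
  by apply: mem_simplices; rewrite inE.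
have bv : aug_boundary k V c0 \in simplices k [set t | below v t].
  rewrite extendE; apply: memv_suml => u us; apply/memvZ/mem_simplices.
  rewrite inE; apply/'forall_implyP => w; rewrite !inE => /andP[_ ws].
  exact: (implyP (forallP vs w)).
rewrite prism_wedge_below // !aug_boundary_wedge linearB /= aug_boundary_wedge.
rewrite (linearB prism) /= prism_wedge_below // push_wedge.
rewrite -[push k g c0](subKr c0) -IH !linearB !linearD /= !opprK.
rewrite -addrA [_ + (prism c0 + _)]addrCA addrA subrK; congr (_ + _).
by rewrite -[_ + _ + _ in LHS]addrA -addrA addrACA subrr add0r.
Qed.

Lemma prism_carried s M : s \subset M -> g @: s \subset M ->
  prism (simplex k s) \in carried k #|s|.+1 M.
Proof.
move=> sM gM; rewrite extendE; elim/below_ind: s sM gM => [|v s vs IH] sM gM.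
  by rewrite enum_set0 mem0v.
move: sM gM; rewrite finset.imsetU1 !finset.subUset !finset.sub1set.
move=> /andP[vM sM] /andP[gvM gM]; rewrite enum_below //= set_enum.
rewrite cardsU1 below_notin // add1n.
apply: wedge_carried => //; apply: rpredB; last exact: IH.
by apply: wedge_carried => //; exact: carried_simplex.
Qed.

Lemma prism_chains d (L : complex V) :
  (forall s, s \in faces L -> s :|: g @: s \in faces L) ->
  forall c, c \in chains k d L -> prism c \in chains k d.+1 L.
Proof.
move=> gL; rewrite /chains -!/(simplices _ _).
apply: simplices_img => s; rewrite inE => /andP[sL /eqP sd].
apply: subvP (carried_chains _ _ (gL _ sL)) _ _; rewrite -sd.
by apply: prism_carried; rewrite ?finset.subsetUl ?finset.subsetUr.
Qed.

(** The homotopy formula for a cycle c with g_* c = 0 exhibits c as the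
    boundary of its prism. In degree 0 the augmented boundary of c need not
    vanish, but it is a multiple of the empty simplex, whose prism is zero. *)
Lemma cycle_boundary_of_push0 d (L : complex V) :
  (forall s, s \in faces L -> s :|: g @: s \in faces L) ->
  forall c, c \in cycles k d L -> push k g c = 0 -> c \in boundaries k d L.
Proof.
move=> gL c; rewrite memv_cap memv_ker => /andP[cL /eqP bc] gc.
have augc : prism (aug_boundary k V c) = 0.
  move: cL bc; rewrite /chains -!/(simplices _ _); case: d => [|d] cL bc.
    rewrite -comp_lfunE -[RHS](zero_lfunE _ c); move: c cL {bc gc}.
    apply: simplices_eq => s; rewrite inE => /andP[_ /cards1P[v ->]].
    rewrite comp_lfunE zero_lfunE [aug_boundary _ _ _]extendE finset.big_set1.
    by rewrite linearZ /= finset.setDv prism0 scaler0.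
  rewrite -(@boundary_aug _ _ d finset.setT) ?bc ?linear0 //.
  apply: subvP cL; apply: simplicesS; apply/fintype.subsetP => s.
  by rewrite !inE finset.subsetT => /andP[].
have := prism_homotopy c; rewrite gc augc subr0 addr0 => <-.
have pc := prism_chains gL cL.
rewrite -(@boundary_aug _ _ d finset.setT) ?memv_img //.
apply: subvP pc; apply: simplicesS; apply/fintype.subsetP => s.
by rewrite !inE finset.subsetT => /andP[].
Qed.

End Prism.

(** Rank-nullity for f_* on the cycles of L that bound in L'. A section r of
    f maps K into L and K' into L', so the image consists of all cycles of K
    that bound in K'. In the kernel the condition of bounding in L' is
    automatic, since r o f is contiguous to the identity on L; hence the
    last term does not involve L'. *)
Lemma dim_cycle_boundary_preimage (k : fieldType) (V W : finType)
    (f : V -> W) (d : nat) (K K' : complex W) (L L' : complex V) :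
  surjective f ->
  (forall s, (s \in faces L) = (f @: s \in faces K)) ->
  (forall s, (s \in faces L') = (f @: s \in faces K')) ->
  faces L \subset faces L' ->
  \dim (cycles k d L :&: boundaries k d L')
  = (\dim (cycles k d K :&: boundaries k d K')
     + \dim (cycles k d L :&: lker (push k f)))%N.
Proof.
move=> fsurj LK LK' LL'.
pose r w := sval (cid (fsurj w)).
have rK w : f (r w) = w by rewrite /r; case: cid.
have frE : f \o r = id by apply/funext => w; exact: rK.
have fr (t : {set W}) : f @: (r @: t) = t.
  by rewrite -finset.imset_comp frE finset.imset_id.
have push_fr c : push k f (push k r c) = c.
  by rewrite -comp_lfunE -push_comp frE push_id id_lfunE.
have rL (t : {set W}) : t \in faces K -> r @: t \in faces L.
  by rewrite LK fr.
have rL' (t : {set W}) : t \in faces K' -> r @: t \in faces L'.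
  by rewrite LK' fr.
have fK (s : {set V}) : s \in faces L -> f @: s \in faces K by rewrite LK.
have fK' (s : {set V}) : s \in faces L' -> f @: s \in faces K' by rewrite LK'.
have push_cycles (A B : finType) (h : A -> B) (M : complex A) (N : complex B) :
    (forall s, s \in faces M -> h @: s \in faces N) ->
    forall c, c \in cycles k d M -> push k h c \in cycles k d N.
  move=> MN c; rewrite !memv_cap !memv_ker => /andP[cM /eqP bc].
  by rewrite (push_chains MN) //= boundary_push bc linear0.
have push_boundaries (A B : finType) (h : A -> B) (M : complex A)
    (N : complex B) : (forall s, s \in faces M -> h @: s \in faces N) ->
    forall c, c \in boundaries k d M -> push k h c \in boundaries k d N.
  move=> MN c /memv_imgP[b bM ->]; rewrite -boundary_push memv_img //.
  exact: push_chains MN _ _.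
rewrite -(limg_ker_dim (push k f)) addnC; congr (_ + _)%N; apply: congr1.
  apply/eqP; rewrite eqEsubv; apply/andP; split; apply/subvP => c.
    move=> /memv_imgP[b]; rewrite memv_cap => /andP[bZ bB] ->.
    by rewrite memv_cap (push_cycles _ _ f L) ?(push_boundaries _ _ f L').
  rewrite memv_cap => /andP[cZ cB]; rewrite -(push_fr c) memv_img // memv_cap.
  by rewrite (push_cycles _ _ r K) ?(push_boundaries _ _ r K').
apply/eqP; rewrite eqEsubv; apply/andP; split; apply/subvP => c.
  by rewrite !memv_cap => /andP[/andP[-> _] ->].
rewrite memv_cap memv_ker => /andP[cZ /eqP fc].
rewrite memv_cap memv_ker fc eqxx andbT memv_cap cZ /=.
apply: subvP (boundaries_mono _ _ LL') _ _.
apply: (@cycle_boundary_of_push0 _ _ (r \o f)) => // [s sL|].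
  rewrite LK finset.imsetU -finset.imset_comp.
  have -> : f \o (r \o f) = f by apply/funext => v; exact: rK.
  by rewrite finset.setUid -LK.
by rewrite push_comp comp_lfunE fc linear0.
Qed.

(** * Moebius inversion along a Galois connection *)

Section MoebiusGalois.
Context {disp : Order.disp_t} {T U : finPOrderType disp}.

(** Summing the push-forward over K <= J counts the I with f I <= J, that is
    I <= g J; so the push-forward is the Moebius inverse of hT o g. A
    function of the lower end alone is the sum over [q, q] <= J of its
    Moebius inverse on U, so it contributes to diagonal intervals only. *)
Lemma moebius_galois (G : galois T U) (hT : ivl T -> int) (hU : ivl U -> int)
    (e : U -> int) :
  (forall J, hT (ivl_map (right_homo G) J) = hU J + e (lo J)) ->
  forall J, lo J != hi J ->
    moebius_inv hU J
    = \sum_(I | ivl_map (left_homo G) I == J) moebius_inv hT I.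
Proof.
move=> hTU J Joff.
pose diag (J : ivl U) := if lo J == hi J then moebius_inv e (lo J) else 0.
suff /(_ J) :
    (fun J => \sum_(I | ivl_map (left_homo G) I == J) moebius_inv hT I)
    =1 (fun J => moebius_inv hU J + diag J).
  by rewrite /diag (negbTE Joff) addr0.
apply: moebius_unique => {Joff}J; rewrite big_split /= -moebius_invP.
transitivity (hT (ivl_map (right_homo G) J)).
  rewrite moebius_invP [RHS](partition_big (ivl_map (left_homo G))
    (fun K => (K <= J)%O)) /=; last first.
    by move=> I; rewrite !ivl_leE => /andP[/galoisP h1 /galoisP h2]; apply/andP.
  apply: eq_bigr => K KJ; apply: eq_bigl => I.
  have [IK|] := eqVneq; rewrite ?andbT ?andbF //; apply/esym.
  move: KJ; rewrite -IK !ivl_leE => /andP[/galoisP h1 /galoisP h2].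
  exact/andP.
rewrite hTU; congr (_ + _); rewrite moebius_invP /diag -big_mkcondr /=.
rewrite [RHS](reindex_onto (fun q => mk_ivl (lexx q)) (@lo _ U)) /=; last first.
  by move=> K /andP[_ /eqP K_diag]; apply: ivlP.
apply: eq_bigl => q; rewrite ivl_leE /lo /hi /= !eqxx !andbT.
by apply/idP/andP => [qJ|[]//]; split=> //; exact: le_trans qJ (lo_le_hi J).
Qed.

End MoebiusGalois.

(** The right adjoint sends u to the largest t with h t <= u; the hypothesis
    on t0 makes the set of such t non-empty. *)
Lemma has_right_adjoint disp (T U : finOrderType disp) (h : T -> U) (t0 : T) :
  {homo h : a b / (a <= b)%O} -> (forall u, (h t0 <= u)%O) ->
  exists G : galois T U, left_adj G = h.
Proof.
move=> h_homo h0.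
have adj u : exists t, forall a, (h a <= u)%O <-> (a <= t)%O.
  case: (@arg_maxP _ _ _ t0 (fun a => (h a <= u)%O) id (h0 u)) => t tu tmax.
  by exists t => a; split=> [/tmax //|at']; exact: le_trans (h_homo _ _ at') tu.
pose g u := sval (cid (adj u)).
have gP a u : (h a <= u)%O <-> (a <= g u)%O := svalP (cid (adj u)) a.
have g_homo : {homo g : a b / (a <= b)%O}.
  by move=> a b ab; apply/gP/(le_trans _ ab)/gP.
by exists (Galois h_homo g_homo gP).
Qed.

Lemma dist_max_le (R : realDomainType) (a b a' b' e : R) :
  `|a - a'| <= e -> `|b - b'| <= e ->
  `|Num.max a b - Num.max a' b'| <= e.
Proof.
rewrite !ler_norml => /andP[? ?] /andP[? ?].
by case: (leP a b) => ?; case: (leP a' b') => ?; apply/andP; split; lra.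
Qed.

(** * Functoriality of Vietoris-Rips diagrams *)

Section DistanceScale.
Variables (R : realType) (X : fpmet R).

Fact dist_in_fset (x y : X) : dist x y \in dist_fset X.
Proof. by apply/imfset2P; exists x => //; exists y. Qed.

Definition dist_point (x y : X) : dist_scale X := FSetSub (dist_in_fset x y).

Lemma dist_pointP (q : dist_scale X) : exists p : X * X, q = dist_point p.1 p.2.
Proof.
have /imfset2P[x _ [y _ qxy]] := valP q.
by exists (x, y); apply/val_inj; rewrite /= -qxy.
Qed.

Lemma dist_point_le (x y x' y' : X) :
  (dist_point x y <= dist_point x' y')%O = (dist x y <= dist x' y').
Proof. by []. Qed.

End DistanceScale.

Section Functoriality.
Variables (R : realType) (X Y : fpmet R) (f : metric_mor X Y).

(** Choosing a pair of points that realizes q is harmless by [scale_mapE]: a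
    metric morphism maps pairs at equal distance to pairs at equal distance. *)
Definition scale_map (q : dist_scale X) : dist_scale Y :=
  let p := sval (cid (dist_pointP q)) in dist_point (f p.1) (f p.2).

Lemma scale_mapE x y : scale_map (dist_point x y) = dist_point (f x) (f y).
Proof.
rewrite /scale_map; case: cid => -[x' y'] /= /(congr1 val) /= xy.
by apply/val_inj/le_anti; rewrite /= !mfun_homo ?xy.
Qed.

Lemma scale_map_homo : {homo scale_map : a b / (a <= b)%O}.
Proof.
move=> a b; have [[x y] ->] := dist_pointP a.
have [[x' y'] ->] := dist_pointP b.
by rewrite !scale_mapE !dist_point_le; exact: mfun_homo.
Qed.

Lemma scale_galois : exists G : galois (dist_scale X) (dist_scale Y),
  left_adj G = scale_map.
Proof.
have /card_gt0P[x0 _] := pts_gt0 X.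
apply: (has_right_adjoint (t0 := dist_point x0 x0)) => [|r].
  exact: scale_map_homo.
rewrite scale_mapE; have [[y y'] ->] := dist_pointP r.
by rewrite dist_point_le distxx dist_ge0.
Qed.

(** A simplex has diameter at most g r iff its image has diameter at most r:
    the adjunction, applied to each pair of its vertices. *)
Lemma VR_preimage (G : galois (dist_scale X) (dist_scale Y)) r s :
  left_adj G = scale_map ->
  (s \in faces (VR_complex (right_adj G r)))
  = (f @: s \in faces (VR_complex r)).
Proof.
move=> GE; rewrite !inE imset_eq0; congr andb.
have q0 := scale_ge0 (valP (right_adj G r)); have r0 := scale_ge0 (valP r).
have adj x y :
    (dist x y <= val (right_adj G r)) <-> (dist (f x) (f y) <= val r).
  have := galoisP G (dist_point x y) r; rewrite GE scale_mapE.
  exact: iff_sym.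
apply/(diam_leP _ q0)/(diam_leP _ r0) => h; last move=> x y xs ys.
  by move=> _ _ /imsetP[x xs ->] /imsetP[y ys ->]; apply/adj; exact: h.
by apply/adj; apply: h; exact: imset_f.
Qed.

Lemma metric_cost_ge x y :
  `|dist x y - dist (f x) (f y)| <= metric_cost f.
Proof.
apply: le_trans (le_bigmax _ _ x).
exact: (le_bigmax _ (fun y => `|dist x y - dist (f x) (f y)|) y).
Qed.

Lemma VR_dgm_mor (k : fieldType) (d : nat) :
  exists F : dgm_mor (PD_diagram k d (VR X)) (PD_diagram k d (VR Y)),
    dgm_cost F <= 2 * metric_cost f.
Proof.
have [G GE] := scale_galois.
have mult (J : ivl (dist_scale Y)) : lo J != hi J ->
    (PD_diagram k d (VR Y)) J
    = (\sum_(I : ivl (dist_scale X) | ivl_map (left_homo G) I == J)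
        (PD_diagram k d (VR X)) I)%N.
  move=> Joff; apply/eqP; rewrite -eqz_nat; apply/eqP.
  rewrite (big_morph Posz PoszD erefl) /= gez0_abs ?PD_ge0 //.
  rewrite [RHS](eq_bigr (@PD R k d (VR X))); last first.
    by move=> I _; rewrite gez0_abs ?PD_ge0.
  (* The excess of X over Y, a function of the lower end only. *)
  pose e r : int := (\dim (cycles k d (VR_complex (right_adj G r))
                            :&: lker (push k f)))%:Z.
  apply: (@moebius_galois _ _ _ G _ _ e) Joff => {}J.
  rewrite /ZB -PoszD; congr Posz; apply: dim_cycle_boundary_preimage.
  - exact: mfun_surj.
  - by move=> s; exact: VR_preimage.
  - by move=> s; exact: VR_preimage.
  - by apply: (@fcpx_homo _ (VR X)); exact/right_homo/lo_le_hi.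
pose F : dgm_mor (PD_diagram k d (VR X)) (PD_diagram k d (VR Y)) :=
  @DgmMor R (PD_diagram k d (VR X)) (PD_diagram k d (VR Y)) G mult.
exists F; have c0 := metric_cost_ge0 f.
have shift (q : dist_scale X) :
    `|val q - val (left_adj G q)| <= metric_cost f.
  by have [[x y] ->] := dist_pointP q; rewrite GE scale_mapE metric_cost_ge.
have shift2 (a b : dist_scale X) : `|(`|val a - val b|
    - `|val (left_adj G a) - val (left_adj G b)|)| <= 2 * metric_cost f.
  apply: le_trans (ler_dist_dist _ _) _.
  have := shift a; have := shift b; rewrite !ler_norml.
  by move=> /andP[? ?] /andP[? ?]; apply/andP; split; lra.
rewrite /dgm_cost; apply/bigmax_leP; split=> [|I _]; first by rewrite mulr_ge0.
apply/bigmax_leP; split=> [|J _]; first by rewrite mulr_ge0.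
apply: dist_max_le; exact: shift2.
Qed.

End Functoriality.

Lemma edit_dist_VR (R : realType) (k : fieldType) (X Y : fpmet R) (d : nat) :
  (edit_dist (Dgm R) (PD_diagram k d (VR X)) (PD_diagram k d (VR Y))
    <= 2%:E * edit_dist (CatMet R) X Y)%E.
Proof.
have zz (A B : CatMet R) (p : zigzag A B) :
    exists q : @zigzag R (Dgm R) (PD_diagram k d (VR A))
                 (PD_diagram k d (VR B)),
      zigzag_cost q <= 2 * zigzag_cost p.
  elim: p => {A B} [A|A D B f p [q pq]|A D B f p [q pq]].
  - by exists (zz_nil _); rewrite /= mulr0.
  - have [F Ff] := VR_dgm_mor f k d.
    by exists (@zz_fwd R (Dgm R) _ _ _ F q); rewrite /= mulrDr lerD.
  - have [F Ff] := VR_dgm_mor f k d.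
    by exists (@zz_bwd R (Dgm R) _ _ _ F q); rewrite /= mulrDr lerD.
rewrite -lee_pdivrMl //; apply: le_ereal_inf_tmp => _ [p ->].
have [q qp] := zz _ _ p.
rewrite lee_pdivrMl // -EFinM; apply: le_trans (ereal_inf_lbound _) _.
  by exists q.
by rewrite lee_fin.
Qed.

(** * Edit distance of metrics and distortion *)

Lemma metric_cost_le (R : realType) (X Y : fpmet R) (f : metric_mor X Y)
    (e : R) :
  0 <= e -> (forall x y, `|dist x y - dist (f x) (f y)| <= e) ->
  metric_cost f <= e.
Proof.
move=> e0 fe; apply/bigmax_leP; split=> // x _.
by apply/bigmax_leP; split=> // y _; exact: fe.
Qed.

Section ZigzagCat.
Variables (R : realType) (C : cost_category R).

Fixpoint zz_cat (A D B : C) (p : zigzag A D) : zigzag D B -> zigzag A B :=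
  match p with
  | zz_nil _ => id
  | zz_fwd _ _ _ f p' => fun q => zz_fwd f (zz_cat p' q)
  | zz_bwd _ _ _ f p' => fun q => zz_bwd f (zz_cat p' q)
  end.

Lemma zz_cat_cost (A D B : C) (p : zigzag A D) (q : zigzag D B) :
  zigzag_cost (zz_cat p q) = zigzag_cost p + zigzag_cost q.
Proof.
elim: p q => {A D} [A|A E D f p IH|A E D f p IH] q /=; first by rewrite add0r.
  by rewrite IH addrA.
by rewrite IH addrA.
Qed.

End ZigzagCat.

(** Kept apart from the bundled spaces because interpolation varies the
    distance on one fixed set of points. *)
Record pseudo_metric (R : realType) (Z : Type) (D : Z -> Z -> R) : Prop :=
  PseudoMetric {
    pmet_ge0 : forall x y, 0 <= D x y;
    pmet_refl : forall x, D x x = 0;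
    pmet_sym : forall x y, D x y = D y x;
    pmet_triangle : forall x y z, D x z <= D x y + D y z }.

Lemma fpmet_pseudo_metric (R : realType) (X : fpmet R) (Z : Type) (h : Z -> X) :
  pseudo_metric (fun x y => dist (h x) (h y)).
Proof.
split=> *; [exact: dist_ge0|exact: distxx|exact: dist_sym|].
exact: dist_triangle.
Qed.

Section Interpolation.
Variables (R : realType) (Z : finType) (Z_gt0 : (0 < #|Z|)%N).
Implicit Types D : Z -> Z -> R.

Definition pmet D (DP : pseudo_metric D) : fpmet R :=
  FPMet Z_gt0 (pmet_ge0 DP) (pmet_refl DP) (pmet_sym DP) (pmet_triangle DP).

Definition segment D D' (t : R) : Z -> Z -> R :=
  fun x y => (1 - t) * D x y + t * D' x y.

Lemma segment_pseudo_metric D D' t : pseudo_metric D -> pseudo_metric D' ->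
  0 <= t <= 1 -> pseudo_metric (segment D D' t).
Proof.
move=> [D0 Dxx Ds Dt] [D0' Dxx' Ds' Dt'] /andP[t0 t1].
have t1' : 0 <= 1 - t by rewrite subr_ge0.
split=> [x y|x|x y|x y z]; rewrite /segment.
- by rewrite addr_ge0 ?mulr_ge0.
- by rewrite Dxx Dxx' !mulr0 addr0.
- by rewrite Ds Ds'.
- by rewrite addrACA -!mulrDr lerD ?ler_wpM2l.
Qed.

Lemma segment_distl D D' t x y : 0 <= t ->
  `|D x y - segment D D' t x y| = t * `|D x y - D' x y|.
Proof.
move=> t0; rewrite -{2}(ger0_norm t0) -normrM /segment; congr `|_|; ring.
Qed.

Lemma segment_distr D D' t x y : t <= 1 ->
  `|segment D D' t x y - D' x y| = (1 - t) * `|D x y - D' x y|.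
Proof.
rewrite -subr_ge0 => t1; rewrite -{1}(ger0_norm t1) -normrM /segment.
congr `|_|; ring.
Qed.

Definition crossings D D' : {set (Z * Z) * (Z * Z)} :=
  [set p | (D p.1.1 p.1.2 < D p.2.1 p.2.2)
        && (D' p.2.1 p.2.2 < D' p.1.1 p.1.2)].

Lemma id_metric_mor D D' (DP : pseudo_metric D) (DP' : pseudo_metric D')
    (e : R) :
  (forall x y z w, D x y <= D z w -> D' x y <= D' z w) ->
  0 <= e -> (forall x y, `|D x y - D' x y| <= e) ->
  exists f : metric_mor (pmet DP) (pmet DP'), metric_cost f <= e.
Proof.
move=> DD' e0 De.
exists (@MetricMor R (pmet DP) (pmet DP') id (@surjective_id Z)
  (fun _ _ _ _ => @DD' _ _ _ _)).
exact: metric_cost_le.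
Qed.

(** Induction on the number of crossings. Without crossings, a strict
    inequality at either end holds at the midpoint, so the midpoint maps to
    both ends. Otherwise cut the segment where the two distances of some
    crossing become equal: each half loses this crossing and acquires no new
    one. *)
Lemma zigzag_segment D D' (DP : pseudo_metric D) (DP' : pseudo_metric D')
    (e : R) :
  0 <= e -> (forall x y, `|D x y - D' x y| <= e) ->
  exists p : @zigzag R (CatMet R) (pmet DP) (pmet DP'), zigzag_cost p <= e.
Proof.
have [n] := ubnP #|crossings D D'|.
elim: n D D' DP DP' e => // n IH D D' DP DP' e cn e0 De.
have [none|/set0Pn[[[x y] [z w]]]] := eqVneq (crossings D D') finset.set0.
  have half : 0 <= (2^-1 : R) <= 1 by apply/andP; split; lra.
  have /andP[half0 half1] := half.
  have MP := segment_pseudo_metric DP DP' half.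
  have nocross x y z w : D x y < D z w -> D' x y <= D' z w.
    move=> Dlt; rewrite leNgt; apply/negP => Dlt'.
    have : ((x, y), (z, w)) \in crossings D D' by rewrite inE /= Dlt.
    by rewrite none inE.
  have e20 : 0 <= e / 2 by lra.
  have [||f fe] := @id_metric_mor _ _ MP DP (e / 2) _ e20.
  - move=> x y z w; rewrite /segment => le; rewrite leNgt; apply/negP => lt.
    by have := nocross _ _ _ _ lt; lra.
  - move=> x y; rewrite distrC segment_distl // mulrC.
    by rewrite ler_pM2r ?De // invr_gt0.
  have [||f' fe'] := @id_metric_mor _ _ MP DP' (e / 2) _ e20.
  - move=> x y z w; rewrite /segment => le; rewrite leNgt; apply/negP => lt.
    have [/nocross|] := ltP (D x y) (D z w); lra.
  - by move=> x y; rewrite segment_distr //; have := De x y; lra.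
  exists (@zz_bwd R (CatMet R) _ _ _ f
    (@zz_fwd R (CatMet R) _ _ _ f' (zz_nil _))).
  by rewrite /= addr0; lra.
rewrite inE /= => /andP[lt lt'].
pose t := (D z w - D x y) / ((D z w - D x y) + (D' x y - D' z w)).
have pos : 0 < (D z w - D x y) + (D' x y - D' z w) by lra.
have t0 : 0 < t by rewrite divr_gt0 // subr_gt0.
have t1 : t < 1 by rewrite ltr_pdivrMr // mul1r ltrDl subr_gt0.
have [t0' t1'] := (ltW t0, ltW t1).
have t01 : 0 <= t <= 1 by rewrite t0' t1'.
have MP := segment_pseudo_metric DP DP' t01.
have meet : segment D D' t x y = segment D D' t z w.
  have : t * ((D z w - D x y) + (D' x y - D' z w)) = D z w - D x y.
    by rewrite divfK // gt_eqF.
  by rewrite /segment; lra.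
have crossl : (#|crossings D (segment D D' t)| < n)%N.
  rewrite -ltnS; apply: leq_trans cn; rewrite ltnS; apply: proper_card.
  apply/fintype.properP; split.
    apply/fintype.subsetP => -[[a b] [a' b']]; rewrite !inE /= => /andP[ab].
    rewrite ab /= /segment => ab'; nra.
  exists ((x, y), (z, w)); first by rewrite inE /= lt.
  by rewrite inE /= meet ltxx andbF.
have crossr : (#|crossings (segment D D' t) D'| < n)%N.
  rewrite -ltnS; apply: leq_trans cn; rewrite ltnS; apply: proper_card.
  apply/fintype.properP; split.
    apply/fintype.subsetP => -[[a b] [a' b']]; rewrite !inE /= => /andP[ab ab'].
    rewrite ab' andbT; move: ab; rewrite /segment => ab; nra.
  exists ((x, y), (z, w)); first by rewrite inE /= lt.
  by rewrite inE /= meet ltxx.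
have [||p pe] := IH _ _ DP MP (t * e) crossl.
- by rewrite mulr_ge0.
- by move=> a b; rewrite segment_distl // ler_wpM2l.
have [||q qe] := IH _ _ MP DP' ((1 - t) * e) crossr.
- by rewrite mulr_ge0 // subr_ge0.
- by move=> a b; rewrite segment_distr // ler_wpM2l // subr_ge0.
exists (zz_cat p q); rewrite zz_cat_cost.
by apply: le_trans (lerD pe qe) _; rewrite mulrBl mul1r addrC subrK.
Qed.

End Interpolation.

(** Only the image W of Z in X * Y matters, and it is finite. The
    pulled-back metrics are joined to X and to Y by projections of cost 0,
    and to each other by [zigzag_segment]. *)
Lemma tripod_zigzag (R : realType) (X Y : fpmet R) (Z : Type)
    (fX : Z -> X) (fY : Z -> Y) (e : R) :
  surjective fX -> surjective fY ->
  (forall z1 z2, `|dist (fX z1) (fX z2) - dist (fY z1) (fY z2)| <= e) ->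
  exists p : @zigzag R (CatMet R) X Y, zigzag_cost p <= e.
Proof.
move=> fXs fYs Ze.
pose W := {p : X * Y | `[< exists z, fX z = p.1 /\ fY z = p.2 >]}.
pose wX (w : W) := (val w).1; pose wY (w : W) := (val w).2.
have wP z : exists w : W, wX w = fX z /\ wY w = fY z.
  have zP : `[< exists z', fX z' = (fX z, fY z).1 /\ fY z' = (fX z, fY z).2 >].
    by apply/asboolP; exists z.
  by exists (exist _ (fX z, fY z) zP).
have wXs : surjective wX.
  by move=> x; have [z <-] := fXs x; have [w [wx _]] := wP z; exists w.
have wYs : surjective wY.
  by move=> y; have [z <-] := fYs y; have [w [_ wy]] := wP z; exists w.
have We (w1 w2 : W) :
    `|dist (wX w1) (wX w2) - dist (wY w1) (wY w2)| <= e.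
  have /asboolP[z1 [x1 y1]] := valP w1; have /asboolP[z2 [x2 y2]] := valP w2.
  by rewrite /wX /wY -x1 -x2 -y1 -y2.
have /card_gt0P[x0 _] := pts_gt0 X; have [w0 _] := wXs x0.
have W_gt0 : (0 < #|{: W}|)%N by apply/card_gt0P; exists w0.
have e0 : 0 <= e by apply: le_trans (We w0 w0).
have pull (U : fpmet R) (h : W -> U) : surjective h ->
    exists f : metric_mor (pmet W_gt0 (fpmet_pseudo_metric h)) U,
      metric_cost f <= 0.
  move=> hs; exists (@MetricMor R (pmet W_gt0 (fpmet_pseudo_metric h)) U h hs
    (fun _ _ _ _ le => le)).
  by apply: metric_cost_le => // w1 w2; rewrite /= subrr normr0.
have [f f0] := pull X wX wXs; have [g g0] := pull Y wY wYs.
have [p pe] := zigzag_segment W_gt0 (fpmet_pseudo_metric wX)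
  (fpmet_pseudo_metric wY) e0 We.
exists (@zz_bwd R (CatMet R) _ _ _ f
  (zz_cat p (@zz_fwd R (CatMet R) _ _ _ g (zz_nil _)))).
by rewrite /= zz_cat_cost /=; lra.
Qed.

(** A forward step A -> D is composed with a tripod over D by taking the
    pullback; a backward step D -> A just extends the left leg. *)
Lemma zigzag_tripod (R : realType) (X Y : CatMet R) (p : zigzag X Y) :
  exists (Z : Type) (fX : Z -> pts X) (fY : Z -> pts Y),
    [/\ surjective fX, surjective fY &
      forall z1 z2, `|dist (fX z1) (fX z2) - dist (fY z1) (fY z2)|
        <= zigzag_cost p].
Proof.
elim: p => {X Y} [A|A D B f p [Z [g [h [gs hs IH]]]]
                 |A D B f p [Z [g [h [gs hs IH]]]]].
- exists (pts A), id, id; split=> [||x y]; [exact: surjective_id..|].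
  by rewrite subrr normr0.
- exists {q : pts A * Z | mfun f q.1 = g q.2}.
  exists (fun q => (sval q).1), (fun q => h (sval q).2); split.
  + move=> a; have [z gz] := gs (mfun f a).
    by exists (exist _ (a, z) (esym gz)).
  + move=> b; have [z hz] := hs b; have [a fa] := mfun_surj f (g z).
    by exists (exist _ (a, z) fa).
  + move=> [[a1 z1] /= fg1] [[a2 z2] /= fg2].
    apply: le_trans (ler_distD (dist (mfun f a1) (mfun f a2)) _ _) _.
    by rewrite lerD ?metric_cost_ge // fg1 fg2.
- exists Z, (fun z => mfun f (g z)), h; split=> // [|z1 z2 /=].
    exact: surjective_comp (mfun_surj f) gs.
  apply: le_trans (ler_distD (dist (g z1) (g z2)) _ _) _.
  by rewrite lerD // distrC metric_cost_ge.
Qed.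

Lemma edit_dist_CatMet (R : realType) (X Y : fpmet R) :
  (edit_dist (CatMet R) X Y = 2%:E * gh_dist X Y)%E.
Proof.
rewrite /gh_dist muleA -EFinM divff ?pnatr_eq0 // mul1e.
apply/eqP; rewrite eq_le; apply/andP; split; apply: le_ereal_inf_tmp.
  move=> _ [Z [fX [fY [fXs fYs ->]]]].
  have /card_gt0P[x0 _] := pts_gt0 X; have [z0 _] := fXs x0.
  have le_distortion z1 z2 :
      ((`|dist (fX z1) (fX z2) - dist (fY z1) (fY z2)|)%:E
        <= distortion fX fY)%E.
    by apply: ereal_sup_ubound; exists z1, z2.
  (* The infinite values are harmless: +oo is above everything, and -oo is
     excluded as Z has a point. *)
  case E: (distortion fX fY) => [r| |]; last 2 first.
  - exact: leey.
  - by have := le_distortion z0 z0; rewrite E.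
  have [|p pr] := @tripod_zigzag R X Y Z fX fY r fXs fYs.
    by move=> z1 z2; have := le_distortion z1 z2; rewrite E lee_fin.
  by apply: le_trans (ereal_inf_lbound _) _; [by exists p|rewrite lee_fin].
move=> _ [p ->]; have [Z [fX [fY [fXs fYs Zp]]]] := zigzag_tripod p.
apply: le_trans (ereal_inf_lbound _) _.
  by exists Z, fX, fY; split.
by apply: ge_ereal_sup => _ [z1 [z2 ->]]; rewrite lee_fin.
Qed.

Local Open Scope ereal_scope.

Theorem theorem1p2p1 (R : realType) (k : fieldType) (X Y : fpmet R) (d : nat) :
  edit_dist (Dgm R) (PD_diagram k d (VR X)) (PD_diagram k d (VR Y))
    <= 2%:E * edit_dist (CatMet R) X Y
  /\ 2%:E * edit_dist (CatMet R) X Y = 4%:E * gh_dist X Y.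
Proof.
split; first exact: edit_dist_VR.
by rewrite edit_dist_CatMet muleA -EFinM -natrM.
Qed.
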